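(* Let $P,Q\in\mathbb{H}[X]$ be two quaternionic polynomials with the degree of $P$ not exceeding that of $Q$. Assume that there exists an imaginary unit $I\in\mathbb{S}$ such that $Q$ is a $\mathbb{C}_I$-polynomial. If $V(Q)\subseteq\overline{\mathbb{B}}$ and $|P(x)|\le|Q(x)|$ for every $x\in\mathbb{S}^3$, then $|P'(x)|\le|Q'(x)|$ for every $x\in\mathbb{S}^3\cap\mathbb{C}_I$.
   Context: $\mathbb{H}$ is the real algebra of quaternions with its Euclidean norm $|\cdot|$. $\mathbb{H}[X]$ is the ring of polynomials $P(X)=\sum_{h=0}^d X^h a_h$ with coefficients $a_h\in\mathbb{H}$ written on the right of the indeterminate. Such a polynomial is evaluated at $x\in\mathbb{H}$ by $P(x)=\sum_{h=0}^d x^h a_h$, and its derivative is the polynomial $P'(X)=\sum_{h=1}^d X^{h-1}h\,a_h$. The zero set is $V(P)=\{x\in\mathbb{H} : P(x)=0\}$. $\mathbb{S}=\{I\in\mathbb{H} : I^2=-1\}$ is the 2-sphere of imaginary units; for $I\in\mathbb{S}$, $\mathbb{C}_I=\{\alpha+\beta I:\alpha,\beta\in\mathbb{R}\}\subset\mathbb{H}$ is the real subalgebra generated by $I$. A polynomial is called a $\mathbb{C}_I$-polynomial if all its coefficients belong to $\mathbb{C}_I$. $\mathbb{B}=\{x\in\mathbb{H} : |x|<1\}$ is the open unit ball, $\overline{\mathbb{B}}$ its closure, and $\mathbb{S}^3=\{x\in\mathbb{H} : |x|=1\}$ is the unit sphere. *)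

(* Defs.v *)
From HB Require Import structures.
From mathcomp Require Import all_boot all_order all_algebra.
From mathcomp Require Import ring lra.
From mathcomp Require Import all_classical all_reals all_analysis.
Set Implicit Arguments.
Unset Strict Implicit.
Unset Printing Implicit Defensive.
Import Order.TTheory GRing.Theory Num.Theory.
Import numFieldNormedType.Exports.
Local Open Scope classical_set_scope.
Local Open Scope ring_scope.

(* Quat a b c d is a + b i + c j + d k. *)
Record quat (R : Type) := Quat { q_re : R; q_i : R; q_j : R; q_k : R }.

Section QuatAlgebra.
Variable R : realType.
Implicit Types (a : R) (x y z : quat R).

Definition quat_tuple x := (q_re x, q_i x, q_j x, q_k x).
Definition tuple_quat (t : R * R * R * R) :=
  let: (a, b, c, d) := t in Quat a b c d.
Fact quat_tupleK : cancel quat_tuple tuple_quat.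
Proof. by case. Qed.

HB.instance Definition _ := Choice.copy (quat R) (can_type quat_tupleK).

Definition quat_add x y :=
  Quat (q_re x + q_re y) (q_i x + q_i y) (q_j x + q_j y) (q_k x + q_k y).
Definition quat_opp x := Quat (- q_re x) (- q_i x) (- q_j x) (- q_k x).
Definition quat_scale a x := Quat (a * q_re x) (a * q_i x) (a * q_j x) (a * q_k x).
Definition quat_mul x y := Quat
  (q_re x * q_re y - q_i x * q_i y - q_j x * q_j y - q_k x * q_k y)
  (q_re x * q_i y + q_i x * q_re y + q_j x * q_k y - q_k x * q_j y)
  (q_re x * q_j y - q_i x * q_k y + q_j x * q_re y + q_k x * q_i y)
  (q_re x * q_k y + q_i x * q_j y - q_j x * q_i y + q_k x * q_re y).

Fact quat_addA : associative quat_add.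
Proof. by move=> x y z; congr Quat; rewrite /= addrA. Qed.
Fact quat_addC : commutative quat_add.
Proof. by move=> x y; congr Quat; rewrite /= addrC. Qed.
Fact quat_add0 : left_id (Quat 0 0 0 0) quat_add.
Proof. by case=> *; congr Quat; rewrite /= add0r. Qed.
Fact quat_addN : left_inverse (Quat 0 0 0 0) quat_opp quat_add.
Proof. by case=> *; congr Quat; rewrite /= addNr. Qed.

HB.instance Definition _ := GRing.isZmodule.Build (quat R)
  quat_addA quat_addC quat_add0 quat_addN.

Fact quat_mulA : associative quat_mul.
Proof. by move=> x y z; congr Quat => /=; ring. Qed.
Fact quat_mul1l : left_id (Quat 1 0 0 0) quat_mul.
Proof. by case=> *; congr Quat => /=; ring. Qed.
Fact quat_mul1r : right_id (Quat 1 0 0 0) quat_mul.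
Proof. by case=> *; congr Quat => /=; ring. Qed.
Fact quat_mulDl : left_distributive quat_mul quat_add.
Proof. by move=> x y z; congr Quat => /=; ring. Qed.
Fact quat_mulDr : right_distributive quat_mul quat_add.
Proof. by move=> x y z; congr Quat => /=; ring. Qed.
Fact quat_oner_neq0 : Quat 1 0 0 0 != 0 :> quat R.
Proof. by apply/eqP => -[] /eqP; rewrite oner_eq0. Qed.

HB.instance Definition _ := GRing.Zmodule_isNzRing.Build (quat R)
  quat_mulA quat_mul1l quat_mul1r quat_mulDl quat_mulDr quat_oner_neq0.

Fact quat_scaleA a b x : quat_scale a (quat_scale b x) = quat_scale (a * b) x.
Proof. by congr Quat; rewrite /= mulrA. Qed.
Fact quat_scale1 : left_id 1 quat_scale.
Proof. by case=> *; congr Quat; rewrite /= mul1r. Qed.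
Fact quat_scaleDr : right_distributive quat_scale +%R.
Proof. by move=> a x y; congr Quat; rewrite /= mulrDr. Qed.
Fact quat_scaleDl x : {morph quat_scale^~ x : a b / a + b}.
Proof. by move=> a b; congr Quat; rewrite /= mulrDl. Qed.

HB.instance Definition _ := GRing.Zmodule_isLmodule.Build R (quat R)
  quat_scaleA quat_scale1 quat_scaleDr quat_scaleDl.

Fact quat_scaleAl a x y : a *: (x * y) = a *: x * y.
Proof. by congr Quat => /=; ring. Qed.
Fact quat_scaleAr a x y : a *: (x * y) = x * (a *: y).
Proof. by congr Quat => /=; ring. Qed.

HB.instance Definition _ := GRing.Lmodule_isLalgebra.Build R (quat R) quat_scaleAl.
HB.instance Definition _ := GRing.Lalgebra_isAlgebra.Build R (quat R) quat_scaleAr.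

Definition quat_norm x : R :=
  Num.sqrt (q_re x ^+ 2 + q_i x ^+ 2 + q_j x ^+ 2 + q_k x ^+ 2).

Fact quat_normD x y : quat_norm (x + y) <= quat_norm x + quat_norm y.
Proof.
case: x y => a b c d [a' b' c' d']; rewrite /quat_norm /=.
set s := _ + _ + _ + _; set u := (X in _ <= Num.sqrt X + _).
set v := (X in _ <= _ + Num.sqrt X).
have u0 : 0 <= u by rewrite /u !addr_ge0 ?sqr_ge0.
have v0 : 0 <= v by rewrite /v !addr_ge0 ?sqr_ge0.
have uv0 : 0 <= Num.sqrt u + Num.sqrt v by rewrite addr_ge0 ?sqrtr_ge0.
rewrite -(ger0_norm uv0) -sqrtr_sqr ler_wsqrtr// sqrrD !sqr_sqrtr// -sqrtrM//.
have -> : s = u + (a * a' + b * b' + c * c' + d * d') *+ 2 + v.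
  by rewrite /s /u /v; ring.
rewrite lerD2r lerD2l lerMn2r /=; apply: le_trans (ler_norm _) _.
rewrite -sqrtr_sqr ler_wsqrtr// -subr_ge0.
have -> : u * v - (a * a' + b * b' + c * c' + d * d') ^+ 2 =
    (a * b' - b * a') ^+ 2 + (a * c' - c * a') ^+ 2 + (a * d' - d * a') ^+ 2 +
    (b * c' - c * b') ^+ 2 + (b * d' - d * b') ^+ 2 + (c * d' - d * c') ^+ 2.
  by rewrite /u /v; ring.
by rewrite !addr_ge0 ?sqr_ge0.
Qed.

Fact quat_normZ a x : quat_norm (a *: x) = `|a| * quat_norm x.
Proof.
by rewrite /quat_norm /= !exprMn -!mulrDr sqrtrM ?sqr_ge0// sqrtr_sqr.
Qed.

Fact quat_norm0_eq0 x : quat_norm x = 0 -> x = 0.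
Proof.
case: x => a b c d /eqP; rewrite /quat_norm /= sqrtr_eq0 => le0.
have sq0 (t : R) : t ^+ 2 <= 0 -> t = 0.
  by move=> t0; apply/eqP; rewrite -sqrf_eq0 eq_le t0 sqr_ge0.
by congr Quat; apply: sq0; nra.
Qed.

HB.instance Definition _ := Lmodule_isNormed.Build R (quat R)
  quat_normD quat_normZ quat_norm0_eq0.

End QuatAlgebra.

Section QuatPolynomials.
Variable R : realType.
Implicit Types (P : {poly quat R}) (I x : quat R).

(* Coefficients stand on the right of the powers of x, whereas the library's
   P.[x] puts them on the left. *)
Definition qeval P x : quat R := \sum_(h < size P) x ^+ h * P`_h.

Definition zero_set P : set (quat R) := [set x | qeval P x = 0].

Definition imaginary_units : set (quat R) := [set I | I ^+ 2 = -1].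

Definition slice I : set (quat R) :=
  [set x | exists alpha beta : R, x = alpha%:A + beta *: I].

Definition slice_poly I P := forall h : nat, slice I P`_h.

Definition unit_ball : set (quat R) := [set x | `|x| < 1].

Definition unit_sphere : set (quat R) := [set x | `|x| = 1].

End QuatPolynomials.

Arguments imaginary_units {R}.
Arguments unit_ball {R}.
Arguments unit_sphere {R}.

(* Main.v *)
From HB Require Import structures.
Require Import Defs.
From mathcomp Require Import all_boot all_order all_algebra separable.
From mathcomp Require Import ring lra complex.
From mathcomp Require Import all_classical all_reals all_analysis.
Import Order.TTheory GRing.Theory Num.Theory.
Import numFieldNormedType.Exports.
Local Open Scope classical_set_scope.
Local Open Scope ring_scope.

(** The inequality rests on a quadrature formula for the derivative. Let q be a
    complex polynomial of degree n >= 1 with all its zeros in the open unit disk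
    and let |x| = 1. There are nodes t on the unit circle and complex weights w
    such that every complex polynomial p of degree at most n satisfies
      p'(x) = sum_t w_t p(t),   while   sum_t |w_t| |q(t)| = |q'(x)|.

    The nodes are x itself and the n zeros of a combination of q and of its
    reciprocal polynomial qs(z) = z^n conj(q(1 / conj z)),
      N(z) = conj(d) q(z) + x^(-n) d qs(z),   d = x q'(x).
    Both coefficients have the same modulus, and |q| = |qs| only on the circle
    ([recip_poly_eq_norm]), so all zeros of N lie on the circle; they are simple
    because there 2 Re (t q'(t) / q(t)) > n ([logd_circle_gt]). Interpolation at
    these n + 1 nodes ([deriv_interpolation]) gives the first identity. So far
    any ratio of modulus 1 between the two coefficients would do, as long as
    N(x) <> 0; the choice made here is the one for which all the numbers w_t q(t)
    are nonnegative multiples of q'(x), which turns the triangle inequality for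
    q'(x) = sum_t w_t q(t) into an equality ([bernstein_quadrature]).

    Now identify the complex numbers with the slice of I. The weights act by left
    multiplication, the coefficients of P stand on the right, and the formula is
    exact on every power of X; hence it differentiates the quaternionic
    polynomial P as well, at every point of the slice
    ([qeval_deriv_quadrature]). The nodes lie on the unit sphere, so
      |P'(x)| <= sum_t |w_t| |P(t)| <= sum_t |w_t| |Q(t)| = |Q'(x)|.

    Zeros of Q on the unit circle are avoided by using the formula of the dilated
    polynomial Q(rho X) with rho > 1, whose zeros are in the open disk and which
    dominates Q on the circle ([norm_sub_dilate]). This gives
    |P'(x)| <= rho |Q'(rho x)|, and rho tends to 1. *)

(** * Interpolation and logarithmic derivatives *)

(** The Lagrange interpolation polynomial of p at x and at the zeros of N,
    differentiated at x. *)
Lemma deriv_interpolation (F : fieldType) (N p : {poly F}) (ts : seq F) (x : F) :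
  uniq ts -> (forall t, t \in ts -> root N t /\ N^`().[t] != 0) ->
  (size N <= (size ts).+1)%N -> N.[x] != 0 -> (size p <= (size ts).+1)%N ->
  p^`().[x] = p.[x] * (N^`().[x] / N.[x])
    + \sum_(t <- ts) p.[t] * (- (N.[x] / ((x - t) ^+ 2 * N^`().[t]))).
Proof.
move=> ts_uniq tsP szN Nx0 szp.
pose M t := N %/ ('X - t%:P).
have NE t : t \in ts -> N = M t * ('X - t%:P).
  by move=> /tsP[rt _]; rewrite divpK // dvdp_XsubCl.
have MtE t : t \in ts -> (M t).[t] = N^`().[t].
  by move=> tin; rewrite [in RHS](NE t tin) derivM derivXsubC mulr1 !hornerE subrr; ring.
have Ms0 t s : t \in ts -> s \in ts -> s != t -> (M t).[s] = 0.
  move=> tin /[dup] sin /tsP[/rootP Ns0 _] st; apply/eqP.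
  have := Ns0; rewrite (NE t tin) !hornerE => /eqP.
  by rewrite mulf_eq0 subr_eq0 (negPf st) orbF.
have xt0 t : t \in ts -> x - t != 0.
  by move=> /tsP[/rootP Nt _]; rewrite subr_eq0; apply: contraNneq Nx0 => ->; rewrite Nt.
have MxE t : t \in ts -> (M t).[x] = N.[x] / (x - t).
  by move=> tin; rewrite [in RHS](NE t tin) !hornerE mulfK// xt0.
have szM t : t \in ts -> (size (M t) <= size ts)%N.
  move=> tin; rewrite /M size_divp ?polyXsubC_eq0// size_XsubC subn1.
  by case: (size N) szN.
(* g interpolates p: M t vanishes at all nodes in ts except t, and N at all of ts. *)
pose w t := p.[t] / ((t - x) * N^`().[t]).
pose h := \sum_(t <- ts) w t *: M t.
pose g := (p.[x] / N.[x]) *: N + h * ('X - x%:P).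
have pg : p = g.
  apply/eqP; rewrite -subr_eq0; apply/eqP/(@roots_geq_poly_eq0 _ _ (x :: ts)).
  - rewrite /= /root; apply/andP; split.
      by rewrite !hornerE /= subrr mulr0 addr0 divfK// subrr.
    apply/allP => s sin; rewrite /root !hornerE /=.
    have [/rootP Ns0 N's0] := tsP s sin.
    rewrite Ns0 mulr0 add0r /h horner_sum (big_rem s) //= big_seq big1 ?addr0.
      rewrite hornerZ MtE // /w.
      have sx : s - x != 0 by rewrite -opprB oppr_eq0 xt0.
      by apply/eqP; field; rewrite N's0 sx.
    by move=> t; rewrite mem_rem_uniq // => /andP[ts' tin];
      rewrite hornerZ Ms0 ?mulr0// eq_sym.
  - rewrite /= ts_uniq andbT; apply/negP => xin.
    by have := xt0 x xin; rewrite subrr eqxx.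
  - apply: leq_trans (size_polyD _ _) _; rewrite size_polyN geq_max szp /=.
    apply: leq_trans (size_polyD _ _) _; rewrite geq_max.
    rewrite (leq_trans (size_scale_leq _ _) szN) /=.
    apply: leq_trans (size_polyMleq _ _) _; rewrite size_XsubC addn2 /= ltnS.
    rewrite /h big_seq; apply: (leq_trans (size_sum _ _ _)).
    apply/bigmax_leqP_seq => t tin _; apply: leq_trans (size_scale_leq _ _) _.
    exact: szM.
rewrite [in LHS]pg derivD derivM derivXsubC derivZ hornerD hornerZ hornerD.
rewrite !hornerM hornerXsubC subrr mulr0 add0r hornerC mulr1 mulrAC -mulrA.
congr (_ + _).
rewrite /h horner_sum; apply: eq_big_seq => t tin; rewrite hornerZ MxE // /w.
have [_ N't0] := tsP t tin; have xt := xt0 t tin.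
have tx : t - x != 0 by rewrite -opprB oppr_eq0.
by field; rewrite tx N't0 xt.
Qed.

Lemma horner_deriv_prod (F : fieldType) (I : eqType) (r : seq I) (f : I -> {poly F}) t :
  (forall i, i \in r -> (f i).[t] != 0) ->
  (\prod_(i <- r) f i)^`().[t] =
    (\prod_(i <- r) f i).[t] * \sum_(i <- r) (f i)^`().[t] / (f i).[t].
Proof.
elim: r => [|i r IH] fr; first by rewrite !big_nil derivC !hornerE.
have fi0 : (f i).[t] != 0 by rewrite fr ?mem_head.
rewrite !big_cons derivM !hornerE IH; last by move=> j jr; rewrite fr ?in_cons ?jr ?orbT.
by field.
Qed.

(** * A polynomial and its reciprocal on the unit circle *)

Section UnitCircle.
Variable C : numClosedFieldType.
Implicit Types (a t x z : C) (rs : seq C).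

Lemma conj_circle t : `|t| = 1 -> t^* = t^-1.
Proof. by move=> t1; rewrite invC_norm t1 expr1n invr1 mul1r. Qed.

Definition root_prod rs : {poly C} := \prod_(a <- rs) ('X - a%:P).
(** This is z^n conj(q(1 / conj z)) for q the product of the X - a; the product form
    makes it a polynomial even when 0 is among the a. *)
Definition recip_poly rs : {poly C} := \prod_(a <- rs) (1 - a^* *: 'X).
(** The value t q'(t) / q(t) for q the product of the X - a. *)
Definition logd rs t := \sum_(a <- rs) t / (t - a).

Lemma circle_root_neq a t : `|a| < 1 -> `|t| = 1 -> t - a != 0.
Proof. by move=> a1 t1; rewrite subr_eq0; apply: contraTneq a1 => <-; rewrite t1 ltxx. Qed.

Lemma circle_refl_neq a t : `|a| < 1 -> `|t| = 1 -> 1 - a^* * t != 0.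
Proof.
move=> a1 t1; have t0 : t != 0 by rewrite -normr_gt0 t1.
rewrite (_ : 1 - _ = t * (t - a)^*) ?mulf_neq0 ?conjC_eq0 ?circle_root_neq //.
by rewrite rmorphB /= (conj_circle t t1); field.
Qed.

Lemma horner_root_prod rs t : (root_prod rs).[t] = \prod_(a <- rs) (t - a).
Proof. by rewrite horner_prod; apply: eq_bigr => a _; rewrite !hornerE. Qed.

Lemma horner_recip_poly rs t : (recip_poly rs).[t] = \prod_(a <- rs) (1 - a^* * t).
Proof. by rewrite horner_prod; apply: eq_bigr => a _; rewrite !hornerE. Qed.

Lemma recip_poly_circle rs t : `|t| = 1 ->
  (recip_poly rs).[t] = t ^+ size rs * (root_prod rs).[t]^*.
Proof.
move=> t1; have t0 : t != 0 by rewrite -normr_gt0 t1.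
rewrite horner_recip_poly horner_root_prod.
elim: rs => [|a rs IH]; first by rewrite !big_nil rmorph1 mulr1.
rewrite !big_cons IH /= rmorphM rmorphB /= (conj_circle t t1) exprS.
by field.
Qed.

Lemma size_recip_poly rs : (size (recip_poly rs) <= (size rs).+1)%N.
Proof.
elim: rs => [|a rs IH]; first by rewrite /recip_poly big_nil size_poly1.
rewrite /recip_poly big_cons -/(recip_poly rs) mulrBl mul1r -scalerAl -commr_polyX.
apply: leq_trans (size_polyD _ _) _; rewrite geq_max (leq_trans IH)//= size_polyN.
apply: leq_trans (size_scale_leq _ _) _; apply: leq_trans (size_polyMleq _ _) _.
by rewrite size_polyX addn2.
Qed.

Lemma coef_recip_poly rs : (recip_poly rs)`_(size rs) = \prod_(a <- rs) (- a^*).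
Proof.
elim: rs => [|a rs IH]; first by rewrite /recip_poly !big_nil coefC.
rewrite /recip_poly !big_cons -/(recip_poly rs) mulrBl mul1r -scalerAl -commr_polyX /=.
rewrite coefB coefZ coefMX /= IH nth_default ?size_recip_poly//.
by ring.
Qed.

(** The identity behind the Schwarz-Pick lemma: the Blaschke factor
    (z - a) / (1 - conj(a) z) is smaller than 1 in modulus inside the unit disk and
    larger outside. *)
Lemma schwarz_factor a z :
  `|1 - a^* * z| ^+ 2 - `|z - a| ^+ 2 = (1 - `|a| ^+ 2) * (1 - `|z| ^+ 2).
Proof. by rewrite !normCK !rmorphB rmorph1 rmorphM /= conjCK; ring. Qed.

(** Equality case of the triangle inequality: no cancellation occurs between terms
    of equal phase. *)
Lemma same_phase_quadrature (f : C -> C) (u : C) (wt : seq (C * C)) :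
  (forall y, y \in wt -> exists2 r, 0 <= r & y.1 * f y.2 = u * r) ->
  \sum_(y <- wt) `|y.1| * `|f y.2| = `|\sum_(y <- wt) y.1 * f y.2|.
Proof.
move=> phase; suff [r r0 [-> ->]] : exists2 r, 0 <= r &
    \sum_(y <- wt) y.1 * f y.2 = u * r /\ \sum_(y <- wt) `|y.1| * `|f y.2| = `|u| * r.
  by rewrite normrM (ger0_norm r0).
elim: wt phase => [|y wt IH] phase.
  by exists 0 => //; rewrite !big_nil !mulr0.
have [|r r0 [E1 E2]] := IH.
  by move=> v vin; apply: phase; rewrite in_cons vin orbT.
have [s s0 E3] := phase y (mem_head _ _).
exists (s + r); first exact: addr_ge0.
by rewrite !big_cons E1 E2 -normrM E3 normrM (ger0_norm s0) !mulrDr.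
Qed.

Section Disk.
Variables (rs : seq C).
Hypothesis rs_disk : forall a, a \in rs -> `|a| < 1.

(** Guarantees that a combination of the monic polynomial and of its reciprocal
    with coefficients of equal modulus keeps the degree n. *)
Lemma normr_coef_recip_poly : rs != [::] -> `|(recip_poly rs)`_(size rs)| < 1.
Proof.
rewrite coef_recip_poly normr_prod.
case: rs rs_disk => // a s sd _; rewrite big_cons normrN norm_conjC.
apply: le_lt_trans (sd a (mem_head _ _)); rewrite ler_piMr//.
rewrite big_seq; apply: prodr_ile1 => i si.
by rewrite normr_ge0 normrN norm_conjC ltW// sd// in_cons si orbT.
Qed.

(** Each Blaschke factor lies on the same side of 1 in modulus, and there is at
    least one factor. *)
Lemma recip_poly_eq_norm z : rs != [::] ->
  `|(root_prod rs).[z]| = `|(recip_poly rs).[z]| -> `|z| = 1.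
Proof.
move=> rs0; rewrite horner_root_prod horner_recip_poly !normr_prod => nz.
have ltsq (u v : C) : 0 <= u -> 0 <= v -> 0 < v ^+ 2 - u ^+ 2 -> u < v.
  by move=> u0 v0; rewrite subr_gt0 ltr_pXn2r.
have a1 a : a \in rs -> 0 < 1 - `|a| ^+ 2.
  by move=> ain; rewrite subr_gt0 expr_lt1 // rs_disk.
have rsP : has (mem rs) rs by case: rs rs0 => // a s _; rewrite /= mem_head.
have [z1|z1|//] := real_ltgtP (normr_real z) (real1 C).
- suff : \prod_(a <- rs) `|z - a| < \prod_(a <- rs) `|1 - a^* * z| by rewrite nz ltxx.
  rewrite big_seq [ltRHS]big_seq; apply: ltr_prod => // a ain.
  rewrite normr_ge0 ltsq // schwarz_factor mulr_gt0 ?(a1 a ain) //.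
  by rewrite subr_gt0 expr_lt1.
- suff : \prod_(a <- rs) `|1 - a^* * z| < \prod_(a <- rs) `|z - a| by rewrite nz ltxx.
  rewrite big_seq [ltRHS]big_seq; apply: ltr_prod => // a ain.
  rewrite normr_ge0 ltsq // -oppr_lt0 opprB schwarz_factor pmulr_rlt0 ?(a1 a ain) //.
  by rewrite subr_lt0 expr_gt1.
Qed.

Lemma root_prod_circle_neq0 t : `|t| = 1 -> (root_prod rs).[t] != 0.
Proof.
move=> t1; rewrite horner_root_prod prodf_seq_neq0; apply/allP => a ain /=.
exact: circle_root_neq (rs_disk a ain) t1.
Qed.

Lemma deriv_root_prod_circle t : `|t| = 1 ->
  t * (root_prod rs)^`().[t] = (root_prod rs).[t] * logd rs t.
Proof.
move=> t1; rewrite horner_deriv_prod => [|a ain]; last first.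
  by rewrite hornerXsubC (circle_root_neq _ _ (rs_disk a ain) t1).
rewrite mulrCA mulr_sumr; congr (_ * _); apply: eq_bigr => a _.
by rewrite derivXsubC hornerC hornerXsubC mul1r.
Qed.

(** On the circle a factor 1 - conj(a) t of the reciprocal polynomial has
    logarithmic derivative 1 - conj(t / (t - a)), since conj(t) = 1 / t. *)
Lemma deriv_recip_poly_circle t : `|t| = 1 ->
  t * (recip_poly rs)^`().[t] = (recip_poly rs).[t] * ((size rs)%:R - (logd rs t)^*).
Proof.
move=> t1; have t0 : t != 0 by rewrite -normr_gt0 t1.
have nz a (ain : a \in rs) := circle_refl_neq a t (rs_disk a ain) t1.
rewrite horner_deriv_prod => [|a ain]; last by rewrite !hornerE nz.
rewrite mulrCA mulr_sumr; congr (_ * _).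
rewrite /logd rmorph_sum /= -sum1_size natr_sum -sumrB; apply: eq_big_seq => a ain.
have cE : (t - a)^* = t^-1 - a^* by rewrite rmorphB /= conj_circle.
have h2 := nz a ain; rewrite rmorphM fmorphV /= cE (conj_circle t t1).
rewrite derivB derivC derivZ derivX !hornerE.
change (t * - a^* / (1 - a^* * t) = 1 - t^-1 / (t^-1 - a^*)).
by field; rewrite t0 mulNr h2.
Qed.

(** Each zero a contributes the Poisson kernel
    (1 - |a|^2) / |t - a|^2 = 2 Re (t / (t - a)) - 1. *)
Lemma logd_circle_gt t : rs != [::] -> `|t| = 1 ->
  0 < logd rs t + (logd rs t)^* - (size rs)%:R.
Proof.
move=> rs0 t1; have t0 : t != 0 by rewrite -normr_gt0 t1.
have termE a : a \in rs -> t / (t - a) + (t / (t - a))^* - 1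
     = (1 - `|a| ^+ 2) / `|t - a| ^+ 2.
  move=> ain; have h := circle_root_neq _ _ (rs_disk a ain) t1.
  have cE : (t - a)^* = t^-1 - a^* by rewrite rmorphB /= conj_circle.
  have h' := circle_refl_neq a t (rs_disk a ain) t1.
  rewrite !normCK rmorphM fmorphV /= cE (conj_circle t t1).
  by field; rewrite t0 h mulNr h'.
have term_gt0 a : a \in rs -> 0 < t / (t - a) + (t / (t - a))^* - 1.
  move=> ain; have h := circle_root_neq _ _ (rs_disk a ain) t1.
  by rewrite termE // divr_gt0 ?exprn_gt0 ?normr_gt0 // subr_gt0 expr_lt1 // rs_disk.
rewrite /logd rmorph_sum /= -sum1_size natr_sum -big_split -sumrB /=.
case: rs rs0 term_gt0 => // a s _ gt0; rewrite big_cons ltr_pwDl ?gt0 ?mem_head //.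
by rewrite big_seq sumr_ge0 // => i si; rewrite ltW// gt0 // in_cons si orbT.
Qed.

(** The nodes are x and the zeros of N below. On the circle N takes the value
    conj(d) q(t) + (t / x)^n d conj(q(t)); at x this is 2 Re (conj(d) q(x)) > 0, and
    the logarithmic derivative of N there turns out to be n d conj(q(x)) / (x N(x)).
    This makes the term of the node x in q'(x) = sum_t w_t q(t) a nonnegative multiple
    of q'(x); the terms of the other nodes then have the same phase, because
    - x t / (x - t)^2 = 1 / |x - t|^2 on the circle. *)
Lemma bernstein_quadrature x : rs != [::] -> `|x| = 1 ->
  exists wt : seq (C * C),
  [/\ forall y, y \in wt -> `|y.2| = 1,
      forall p : {poly C}, (size p <= (size rs).+1)%N ->
        p^`().[x] = \sum_(y <- wt) y.1 * p.[y.2]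
    & \sum_(y <- wt) `|y.1| * `|(root_prod rs).[y.2]| = `|(root_prod rs)^`().[x]| ].
Proof.
move=> rs0 x1; have x0 : x != 0 by rewrite -normr_gt0 x1.
set n := size rs; set q := root_prod rs; set qs := recip_poly rs.
have szq : size q = n.+1 by rewrite size_prod_XsubC.
(* d and k are introduced opaquely: [normrM] would see through their definitions. *)
have [d dx] : exists d, d = x * q^`().[x] by exists (x * q^`().[x]).
have qx0 : q.[x] != 0 by exact: root_prod_circle_neq0.
have dE : d = q.[x] * logd rs x by rewrite dx; exact: deriv_root_prod_circle.
have d0 : d != 0.
  rewrite dE mulf_neq0 //; apply/eqP => S0.
  by have := logd_circle_gt x rs0 x1; rewrite S0 rmorph0 addr0 sub0r oppr_gt0 ltrn0.
have [k kE] : exists k, k = x ^- n * d by exists (x ^- n * d).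
have nk : `|k| = `|d^*| by rewrite kE normrM normfV normrX x1 expr1n invr1 mul1r norm_conjC.
pose N := d^* *: q + k *: qs.
have NE z : N.[z] = d^* * q.[z] + k * qs.[z] by rewrite hornerD !hornerZ.
have N'E z : N^`().[z] = d^* * q^`().[z] + k * qs^`().[z].
  by rewrite derivD !derivZ hornerD !hornerZ.
have cd0 : d^* != 0 by rewrite conjC_eq0.
have Ncircle t : N.[t] = 0 -> `|t| = 1.
  move=> /eqP; rewrite NE addr_eq0 => /eqP/(congr1 Num.norm).
  rewrite normrN !normrM nk => /mulfI E.
  by apply: recip_poly_eq_norm => //; apply: E; rewrite normr_eq0.
have NxE : N.[x] = d^* * q.[x] + d * q.[x]^*.
  by rewrite NE recip_poly_circle // -/n kE; field; rewrite expf_neq0.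
have Nx_gt0 : 0 < N.[x].
  have -> : N.[x] = `|q.[x]| ^+ 2 * (logd rs x + (logd rs x)^*).
    by rewrite NxE dE rmorphM normCK /=; ring.
  rewrite mulr_gt0 ?exprn_gt0 ?normr_gt0 //.
  by have := logd_circle_gt x rs0 x1; rewrite subr_gt0; apply: le_lt_trans.
have N'xE : x * N^`().[x] = n%:R * d * q.[x]^*.
  rewrite N'E mulrDr mulrCA [x * (k * _)]mulrCA -dx deriv_recip_poly_circle //.
  rewrite recip_poly_circle // -/n -/q kE {1}dE rmorphM /=.
  by field; rewrite expf_neq0.
(* b is the difference of the logarithmic derivatives of q and of its reciprocal. *)
pose b t := logd rs t + (logd rs t)^* - n%:R.
have N't t : N.[t] = 0 -> t * N^`().[t] = d^* * q.[t] * b t.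
  move=> Nt; have t1 := Ncircle t Nt; rewrite N'E mulrDr mulrCA [t * (k * _)]mulrCA.
  rewrite deriv_recip_poly_circle // deriv_root_prod_circle // [k * _]mulrA.
  move/eqP: Nt; rewrite NE addrC addr_eq0 => /eqP ->.
  by rewrite -/n -/q /b; ring.
have szN : size N = n.+1.
  apply/eqP; rewrite eqn_leq; apply/andP; split.
    apply: leq_trans (size_polyD _ _) _; rewrite geq_max.
    rewrite (leq_trans (size_scale_leq _ _)) ?szq //=.
    by rewrite (leq_trans (size_scale_leq _ _)) ?size_recip_poly.
  rewrite ltnNge; apply/negP => /(nth_default 0)/eqP; rewrite coefD !coefZ.
  have -> : q`_n = 1.
    by have /monicP := monic_prod_XsubC rs xpredT id; rewrite lead_coefE szq.
  rewrite mulr1 addr_eq0 => /eqP/(congr1 Num.norm); rewrite normrN normrM nk.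
  rewrite -[LHS]mulr1 => /mulfI; rewrite normr_eq0 => /(_ cd0) E.
  by have := normr_coef_recip_poly rs0; rewrite -/n -/qs -E ltxx.
have N't0 t : root N t -> N^`().[t] != 0.
  move=> /rootP Nt; have t1 := Ncircle t Nt.
  suff : t * N^`().[t] != 0 by rewrite mulf_eq0 negb_or => /andP[].
  by rewrite N't // !mulf_neq0 // ?root_prod_circle_neq0 // gt_eqF // logd_circle_gt.
(* Simple zeros: N has n distinct ones. *)
have [ts tsE] := closed_field_poly_normal N.
have lcN : lead_coef N != 0 by rewrite lead_coef_eq0 -size_poly_eq0 szN.
have rtN t : (t \in ts) = root N t by rewrite tsE rootZ // root_prod_XsubC.
have szts : size ts = n.
  by apply/succn_inj; rewrite -szN tsE size_scale // size_prod_XsubC.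
have ts_uniq : uniq ts.
  rewrite -separable_prod_XsubC -(eqp_separable (eqp_scale _ lcN)) -tsE unlock.
  by apply: Pdiv.ClosedField.root_coprimep => t; exact: N't0.
pose w t := - (N.[x] / ((x - t) ^+ 2 * N^`().[t])).
pose wt := (N^`().[x] / N.[x], x) :: [seq (w t, t) | t <- ts].
have quad (p : {poly C}) : (size p <= n.+1)%N -> p^`().[x] = \sum_(y <- wt) y.1 * p.[y.2].
  move=> szp; rewrite /wt big_cons big_map /= (@deriv_interpolation _ N p ts) ?szts ?szN //.
  - by congr (_ + _); [rewrite mulrC | apply: eq_bigr => t _; rewrite mulrC].
  - by move=> t; rewrite rtN => rt; split => //; apply: N't0.
  - by rewrite gt_eqF.
exists wt; split=> //.
  move=> y; rewrite in_cons => /orP[/eqP ->//|/mapP[t]].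
  by rewrite rtN => /rootP Nt -> /=; apply: Ncircle.
rewrite (quad q) ?szq //; apply: (@same_phase_quadrature _ q^`().[x]) => y.
rewrite in_cons => /orP[/eqP ->/=|/mapP[t]].
  exists (n%:R * `|q.[x]| ^+ 2 / N.[x]).
    by rewrite divr_ge0 ?mulr_ge0 ?exprn_ge0 ?ler0n ?(ltW Nx_gt0).
  apply: (mulfI x0); rewrite normCK mulrA [x * (_ / _)]mulrA N'xE [RHS]mulrA -dx.
  by field; rewrite gt_eqF.
rewrite rtN => /[dup] rt /rootP Nt -> /=; have t1 := Ncircle t Nt.
have bt : 0 < b t by exact: logd_circle_gt.
have t0 : t != 0 by rewrite -normr_gt0 t1.
have xt0 : x - t != 0.
  by rewrite subr_eq0; apply: contraTneq Nx_gt0 => ->; rewrite Nt ltxx.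
exists (N.[x] / (`|x - t| ^+ 2 * `|d| ^+ 2 * b t)).
  by rewrite divr_ge0 ?(ltW Nx_gt0) // !mulr_ge0 ?exprn_ge0 // ltW.
have N'tE : N^`().[t] = d^* * q.[t] * b t / t by rewrite -N't //; field.
have qt0 : q.[t] != 0 by exact: root_prod_circle_neq0.
apply: (mulfI x0); rewrite [RHS]mulrA -dx /w N'tE !normCK rmorphB /=.
rewrite (conj_circle x x1) (conj_circle t t1).
have tx0 : t - x != 0 by rewrite -opprB oppr_eq0.
by field; rewrite t0 x0 (gt_eqF bt) cd0 d0 mulN1r tx0 xt0 qt0.
Qed.

End Disk.
End UnitCircle.

(** * Zeros in the closed disk *)

(** Moving radially away from the unit disk increases the distance to each of its
    points. *)
Lemma norm_sub_dilate (C : numClosedFieldType) (a t rho : C) :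
  `|a| <= 1 -> `|t| = 1 -> 1 < rho -> `|t - a| <= `|rho * t - a|.
Proof.
move=> a1 t1 rho1.
rewrite -(@ler_pXn2r _ 2) ?nnegrE // -subr_ge0.
have rhoR : rho^* = rho by rewrite conj_Creal // gtr0_real // (lt_trans ltr01).
have -> : `|rho * t - a| ^+ 2 - `|t - a| ^+ 2 =
    (rho - 1) * ((rho - 1) + (1 - `|a| ^+ 2) + `|t - a| ^+ 2).
  have tt : t * t^* = 1 by rewrite -normCK t1 expr1n.
  by rewrite !normCK !rmorphB rmorphM /= rhoR; ring: tt.
have rho10 : 0 <= rho - 1 by rewrite subr_ge0 ltW.
have a2 : 0 <= 1 - `|a| ^+ 2 by rewrite subr_ge0 expr_le1.
by rewrite mulr_ge0 // addr_ge0 ?exprn_ge0 // addr_ge0.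
Qed.

(** The weights are those of the polynomial q(rho X), whose zeros a / rho are in the
    open disk; its derivative at x is rho q'(rho x), and |q| <= |q(rho X)| on the
    circle, factor by factor. *)
Lemma bernstein_quadrature_dilate (C : numClosedFieldType) (q : {poly C}) (x rho : C) :
  (1 < size q)%N -> (forall a, root q a -> `|a| <= 1) -> `|x| = 1 -> 1 < rho ->
  exists wt : seq (C * C),
  [/\ forall y, y \in wt -> `|y.2| = 1,
      forall p : {poly C}, (size p <= size q)%N ->
        p^`().[x] = \sum_(y <- wt) y.1 * p.[y.2]
    & \sum_(y <- wt) `|y.1| * `|q.[y.2]| <= rho * `|q^`().[rho * x]| ].
Proof.
move=> szq q_disk x1 rho1.
have rho_gt0 : 0 < rho by apply: lt_trans rho1.
have rho0 : rho != 0 by rewrite gt_eqF.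
have [rs qE] := closed_field_poly_normal q.
have lc0 : lead_coef q != 0 by rewrite lead_coef_eq0 -size_poly_gt0 ltnW.
have szrs : size q = (size rs).+1 by rewrite qE size_scale // size_prod_XsubC.
have rs_disk a : a \in rs -> `|a| <= 1.
  by move=> ain; apply: q_disk; rewrite qE rootZ // root_prod_XsubC.
pose rs' := [seq a / rho | a <- rs].
have rs'_disk a : a \in rs' -> `|a| < 1.
  move=> /mapP[b bin ->]; rewrite normrM normfV (gtr0_norm rho_gt0).
  by rewrite ltr_pdivrMr // mul1r (le_lt_trans (rs_disk b bin)).
have rs'0 : rs' != [::] by rewrite -size_eq0 size_map -lt0n -ltnS -szrs.
have [wt [wt1 quad wtE]] := bernstein_quadrature C rs' rs'_disk x rs'0 x1.
exists wt; split=> // [p szp|]; first by apply: quad; rewrite size_map -szrs.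
pose c := lead_coef q * rho ^+ size rs.
have qrhoE : q \Po (rho *: 'X) = c *: root_prod C rs'.
  rewrite [in LHS]qE comp_polyZ /c -scalerA; congr (_ *: _).
  rewrite rmorph_prod /root_prod /rs' big_map /=.
  elim: rs {qE szrs rs_disk rs' rs'_disk rs'0 wt wt1 quad wtE c} => [|a rs IH].
    by rewrite !big_nil expr0 scale1r.
  rewrite !big_cons exprS -scalerA [_ ^+ _ *: _]scalerAr -IH scalerAl; congr (_ * _).
  rewrite comp_polyB comp_polyX comp_polyC scalerBr; congr (_ - _).
  by rewrite -mul_polyC -polyCM mulrC divfK.
have q'E : rho * `|q^`().[rho * x]| = `|c| * `|(root_prod C rs')^`().[x]|.
  rewrite -normrM -hornerZ -derivZ -qrhoE deriv_comp derivZ derivX hornerM.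
  by rewrite horner_comp !hornerZ hornerX hornerC mulr1 normrM (gtr0_norm rho_gt0) mulrC.
rewrite q'E -wtE mulr_sumr big_seq [leRHS]big_seq; apply: ler_sum => -[w t] /wt1 /= t1.
rewrite mulrCA ler_wpM2l // -normrM -hornerZ -qrhoE horner_comp.
rewrite qE !hornerE /= !normrM ler_wpM2l // !horner_prod !normr_prod !big_seq.
apply: ler_prod => a ain; rewrite normr_ge0 !hornerE /=.
exact: norm_sub_dilate (rs_disk a ain) t1 rho1.
Qed.

(** * Quaternionic polynomials on a slice *)

Section Quat.
Variable R : realType.
Implicit Types (P Q : {poly quat R}) (x y I : quat R) (z : R[i]).

Lemma quat_norm_sqr y :
  `|y| ^+ 2 = q_re y ^+ 2 + q_i y ^+ 2 + q_j y ^+ 2 + q_k y ^+ 2.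
Proof. by rewrite sqr_sqrtr // !addr_ge0 ?sqr_ge0. Qed.

(** Euler's four-square identity. *)
Lemma quat_normM x y : `|x * y| = `|x| * `|y|.
Proof.
apply/eqP; rewrite -(@eqrXn2 _ 2) ?mulr_ge0 //; apply/eqP.
by rewrite exprMn !quat_norm_sqr /=; ring.
Qed.

Lemma qeval_widen P n x : (size P <= n)%N ->
  qeval P x = \sum_(h < n) x ^+ h * P`_h.
Proof.
move=> szP; rewrite /qeval (big_ord_widen _ (fun h => x ^+ h * P`_h) szP).
rewrite big_mkcond; apply: eq_bigr => h _; case: ltnP => // ?.
by rewrite nth_default // mulr0.
Qed.

(** Keeping the vanishing term h = 0 lets the sum run over the same exponents as the
    one that evaluates P, so that the quadrature formula applies term by term. *)
Lemma qeval_deriv P n x : (size P <= n.+1)%N ->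
  qeval P^`() x = \sum_(h < n.+1) (x ^+ h.-1 *+ h) * P`_h.
Proof.
move=> szP; rewrite big_ord_recl mul0r add0r (@qeval_widen _ n).
  by apply: eq_bigr => h _; rewrite coef_deriv mulrnAr mulrnAl.
apply: leq_trans (size_poly _ _) _.
by case: (size P) szP.
Qed.

Definition slice_emb I z : quat R := (complex.Re z)%:A + complex.Im z *: I.

Lemma slice_emb_is_zmod_morphism I : zmod_morphism (slice_emb I).
Proof. by move=> [a b] [c d]; rewrite /slice_emb /= !scalerBl opprD addrACA. Qed.

HB.instance Definition _ I := GRing.isZmodMorphism.Build R[i] (quat R)
  (slice_emb I) (slice_emb_is_zmod_morphism I).

Lemma slice_embM I : imaginary_units I -> {morph slice_emb I : z w / z * w}.
Proof.
move=> hI [a b] [c d].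
rewrite /slice_emb (_ : _ * _ = ((a * c - b * d) +i* (a * d + b * c))%C) //=.
rewrite mulrDl !mulrDr -!scalerAl -!scalerAr !mul1r mulr1 !scalerA -expr2 hI.
by rewrite scalerBl scalerN scalerDl -!addrA; congr (_ + _); rewrite addrC addrA.
Qed.

Lemma slice_emb1 I : slice_emb I 1 = 1.
Proof. by rewrite /slice_emb /= scale1r scale0r addr0. Qed.

Lemma slice_embX I n : imaginary_units I -> {morph slice_emb I : z / z ^+ n}.
Proof.
move=> hI z; elim: n => [|n IH]; first by rewrite !expr0 slice_emb1.
by rewrite !exprS slice_embM // IH.
Qed.

Lemma slice_embZ I (a : R) z : slice_emb I (a%:C%C * z) = a *: slice_emb I z.
Proof. by case: z => b c; rewrite /slice_emb /= !mul0r subr0 addr0 scalerDr !scalerA. Qed.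

Lemma imaginary_unitE I : imaginary_units I ->
  q_re I = 0 /\ q_i I ^+ 2 + q_j I ^+ 2 + q_k I ^+ 2 = 1.
Proof.
case: I => a b c d; rewrite /imaginary_units /= expr2 => -[/= E1 E2 E3 E4].
have a0 : a = 0.
  apply/eqP; apply: contraT => a0.
  have b0 : b = 0 by apply: (mulfI a0); nra.
  have c0 : c = 0 by apply: (mulfI a0); nra.
  have d0 : d = 0 by apply: (mulfI a0); nra.
  by exfalso; move: E1; rewrite b0 c0 d0; nra.
by split=> //; move: E1; rewrite a0; nra.
Qed.

Lemma norm_slice_emb I z : imaginary_units I -> (`|slice_emb I z|)%:C%C = `|z|.
Proof.
move=> /imaginary_unitE[I0 I1]; case: z => a b.
suff -> : `|slice_emb I (a +i* b)%C| = Num.sqrt (a ^+ 2 + b ^+ 2) by [].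
rewrite -[LHS]ger0_norm // -sqrtr_sqr quat_norm_sqr /= I0.
by congr Num.sqrt; rewrite mulr1 -[b ^+ 2 in RHS]mulr1 -I1; ring.
Qed.

Lemma slice_emb_surj I x : slice I x -> exists z, x = slice_emb I z.
Proof. by move=> [a [b ->]]; exists (a +i* b)%C. Qed.

Lemma closure_unit_ball x : closure unit_ball x -> `|x| <= 1.
Proof.
have cl : closed [set y : quat R | `|y| <= 1].
  apply: (@closed_comp _ _ (fun y : quat R => `|y|) [set r | r <= 1]).
    by move=> y _; apply: norm_continuous.
  exact: closed_le.
suff sub : closure unit_ball `<=` [set y : quat R | `|y| <= 1] by exact: sub.
rewrite [X in _ `<=` X]((closure_id _).1 cl).
by apply: closure_subset => y /ltW.
Qed.

Lemma slice_polyP I Q : slice_poly I Q ->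
  exists2 q : {poly R[i]}, size q = size Q & forall h, Q`_h = slice_emb I q`_h.
Proof.
move=> hQ.
have [f fE] := choice (fun h => slice_emb_surj I _ (hQ h)).
have f0 h : Q`_h != 0 -> f h != 0.
  by rewrite fE; apply: contra_neq => ->; rewrite raddf0.
pose q := \poly_(h < size Q) f h.
exists q => [|h].
  have [Q0|Q0] := posnP (size Q).
    by apply/eqP; rewrite Q0 -leqn0 /q Q0 size_poly.
  by rewrite size_poly_eq // f0 // -lead_coefE lead_coef_eq0 -size_poly_gt0.
rewrite coef_poly; case: ltnP => [_|szh]; first exact: fE.
by rewrite raddf0 nth_default.
Qed.

(** On the slice the coefficients of Q commute with the point, so that the side on
    which they stand is immaterial. *)
Lemma qeval_slice I Q (q : {poly R[i]}) z : imaginary_units I ->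
  (forall h, Q`_h = slice_emb I q`_h) -> qeval Q (slice_emb I z) = slice_emb I q.[z].
Proof.
move=> hI QE; rewrite (qeval_widen Q _ _ (leq_maxl _ (size q))).
rewrite (horner_coef_wide _ (leq_maxr (size Q) _)) raddf_sum; apply: eq_bigr => h _ /=.
by rewrite QE -slice_embX // -slice_embM // mulrC.
Qed.

(** The coefficients of P are arbitrary quaternions: the formula is used on the powers
    of the variable only, and the weights multiply on the left. *)
Lemma qeval_deriv_quadrature I P n z (wt : seq (R[i] * R[i])) :
  imaginary_units I -> (size P <= n.+1)%N ->
  (forall p : {poly R[i]}, (size p <= n.+1)%N ->
     p^`().[z] = \sum_(y <- wt) y.1 * p.[y.2]) ->
  qeval P^`() (slice_emb I z) =
    \sum_(y <- wt) slice_emb I y.1 * qeval P (slice_emb I y.2).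
Proof.
move=> hI szP quad; rewrite (qeval_deriv P n) //.
have monomial (h : 'I_n.+1) : slice_emb I z ^+ h.-1 *+ h =
    \sum_(y <- wt) slice_emb I y.1 * slice_emb I y.2 ^+ h.
  have := quad 'X^h; rewrite size_polyXn => /(_ (ltn_ord h))/(congr1 (slice_emb I)).
  rewrite derivXn hornerMn hornerXn raddfMn /= slice_embX // => ->.
  by rewrite raddf_sum; apply: eq_bigr => y _ /=; rewrite hornerXn slice_embM // slice_embX.
under eq_bigr do rewrite monomial mulr_suml.
rewrite exchange_big; apply: eq_bigr => y _ /=.
rewrite (qeval_widen P n.+1) // mulr_sumr.
by apply: eq_bigr => h _; rewrite mulrA.
Qed.

(** The quadrature formula for P, with |P| <= |Q| at the nodes and the dilation bound
    for the sum of the |w| |Q(t)|. *)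
Lemma bernstein_dilate I P Q x (rho : R) :
  (size P <= size Q)%N -> (1 < size Q)%N ->
  imaginary_units I -> slice_poly I Q ->
  zero_set Q `<=` closure unit_ball ->
  (forall y, unit_sphere y -> `|qeval P y| <= `|qeval Q y|) ->
  unit_sphere x -> slice I x -> 1 < rho ->
  `|qeval P^`() x| <= rho * `|qeval Q^`() (rho *: x)|.
Proof.
move=> szPQ szQ hI hQ hV hPQ x1 xI rho1.
have [q szq QE] := slice_polyP I Q hQ.
have [z xE] := slice_emb_surj I x xI.
have normE w := norm_slice_emb I w hI.
have sphere t : `|t| = 1 -> unit_sphere (slice_emb I t).
  move=> t1; apply/eqP; rewrite -(inj_eq (@complexI R)) normE t1.
  exact/eqP.
have z1 : `|z| = 1 by rewrite -normE -xE x1.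
have rhoC1 : 1 < rho%:C%C :> R[i] by rewrite -[1]/(1%:C%C) ltcR.
have q_disk a : root q a -> `|a| <= 1.
  move=> /rootP qa; rewrite -normE -[1]/(1%:C%C) lecR; apply: closure_unit_ball.
  by apply: hV; rewrite /zero_set /= (qeval_slice I Q q) // qa raddf0.
have szq1 : (1 < size q)%N by rewrite szq.
have [wt [wt1 quad wtE]] := bernstein_quadrature_dilate _ q z _ szq1 q_disk z1 rhoC1.
have Q'E h : (Q^`())`_h = slice_emb I (q^`())`_h.
  by rewrite !coef_deriv QE raddfMn.
have Q'rho : rho%:C%C * `|q^`().[rho%:C%C * z]| =
    (rho * `|qeval Q^`() (rho *: x)|)%:C%C.
  by rewrite rmorphM /= xE -slice_embZ (qeval_slice I _ q^`()) // normE.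
rewrite -lecR -Q'rho; apply: le_trans wtE.
have szP : (size P <= (size q).-1.+1)%N by rewrite prednK ?szq // ltnW.
rewrite xE (qeval_deriv_quadrature I P (size q).-1 z wt) //; last first.
  by rewrite prednK // szq ltnW.
have -> : \sum_(y <- wt) `|y.1| * `|q.[y.2]| =
    (\sum_(y <- wt) `|slice_emb I y.1| * `|qeval Q (slice_emb I y.2)|)%:C%C.
  rewrite rmorph_sum; apply: eq_bigr => y _ /=.
  by rewrite rmorphM /= (qeval_slice I Q q) // !normE.
rewrite lecR; apply: le_trans (ler_norm_sum _ _ _) _.
rewrite big_seq [leRHS]big_seq; apply: ler_sum => y /wt1 y1.
by rewrite quat_normM ler_wpM2l //; apply: hPQ; apply: sphere.
Qed.

(** The passage to the limit rho -> 1 in [bernstein_dilate]. *)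
Lemma cvg_at_right_scaled P x :
  rho * `|qeval P (rho *: x)| @[rho --> (1 : R)^'+] --> `|qeval P x|.
Proof.
apply: cvg_at_right_filter.
rewrite -[X in _ --> `|qeval P X|]scale1r -[X in _ --> X]mul1r.
apply: cvgM; first exact: cvg_id.
apply: cvg_norm.
have qevalZ (rho : R) : qeval P (rho *: x) = \sum_(h < size P) rho ^+ h *: (x ^+ h * P`_h).
  by apply: eq_bigr => h _; rewrite exprZn scalerAl.
under eq_fun do rewrite qevalZ.
rewrite qevalZ.
apply: cvg_big => [|h _].
  exact: add_continuous.
by apply: cvgZ; [exact: exprn_continuous | exact: cvg_cst].
Qed.
End Quat.

Theorem theorem1 (R : realType) (P Q : {poly quat R}) (I : quat R)
  (hdeg : (size P <= size Q)%N)
  (hI : imaginary_units I)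
  (hQ : slice_poly I Q)
  (hV : zero_set Q `<=` closure unit_ball)
  (hPQ : forall x : quat R, unit_sphere x -> `|qeval P x| <= `|qeval Q x|) :
  forall x : quat R, (unit_sphere `&` slice I) x ->
    `|qeval P^`() x| <= `|qeval Q^`() x|.
Proof.
move=> x [x1 xI].
(* The quadrature formula needs a nonconstant Q; otherwise P is constant too. *)
have [szQ|szQ] := leqP (size Q) 1.
  have /size1_polyC -> : (size P <= 1)%N by apply: leq_trans szQ.
  by rewrite derivC /qeval size_poly0 big_ord0 normr0 normr_ge0.
apply: (cvgr_to_ge (cvg_at_right_scaled _ Q^`() x)).
apply: filterS (nbhs_right_gt 1) => rho rho1.
exact: (bernstein_dilate _ I P Q).
Qed.
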